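(* Let $k\ge 2$, let $\sigma\in\{+,-\}^k$, let $n\ge 1$ and let $\pi=\pi_1\cdots\pi_n\in\mathfrak S_n$. Then $\pi\in\mathcal A_n(\Sigma_\sigma)$ if and only if both of the following hold: (i) $\hat\pi^*\in\mathcal C^{\sigma,*}$, i.e. $\hat\pi^*$ admits a $*$-$\sigma$-segmentation; (ii) (condition $(\dagger)$) there exists a $*$-$\sigma$-segmentation $0=e_0\le e_1\le\cdots\le e_k=n$ of $\hat\pi^*$ such that there is no integer $b\ge 1$ with $n-2b\ge 1$ satisfying both • $\rho(\pi_{n-2b},\pi_{n-b},\pi_n)\in\{312,\,132\}$, and • for every $1\le i\le b$ and every $0\le t\le k-1$: $e_t<\pi_{n-b-i}\le e_{t+1}$ if and only if $e_t<\pi_{n-i}\le e_{t+1}$.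
   Context: Fix $k\ge2$ and a signature $\sigma=\sigma_0\sigma_1\cdots\sigma_{k-1}\in\{+,-\}^k$; let $T^+_\sigma=\{t:\sigma_t=+\}$ and $T^-_\sigma=\{t:\sigma_t=-\}$. Let $\mathcal W_k$ be the set of infinite words $s=s_1s_2\cdots$ over the alphabet $\{0,1,\dots,k-1\}$. The linear order $\prec_\sigma$ on $\mathcal W_k$ is defined as follows: for $s\neq t$, let $j$ be the smallest index with $s_j\ne t_j$ and $c=|\{1\le i<j: s_i\in T^-_\sigma\}|$; then $s\prec_\sigma t$ iff either $c$ is even and $s_j<t_j$, or $c$ is odd and $s_j>t_j$. The signed shift is $\Sigma_\sigma:\mathcal W_k\to\mathcal W_k$, $\Sigma_\sigma(s_1s_2s_3\cdots)=s_2s_3\cdots$. For distinct elements $x_1,\dots,x_n$ of a linearly ordered set, $\rho(x_1,\dots,x_n)$ is the permutation of $[n]$ (in one-line notation) whose entries are in the same relative order as $x_1,\dots,x_n$. For $s\in\mathcal W_k$, if $s,\Sigma_\sigma(s),\dots,\Sigma_\sigma^{n-1}(s)$ are pairwise distinct, $\mathrm{Pat}(s,\Sigma_\sigma,n)=\rho(s,\Sigma_\sigma(s),\dots,\Sigma_\sigma^{n-1}(s))$ with respect to $\prec_\sigma$; otherwise it is undefined. $\mathcal A_n(\Sigma_\sigma)$ is the set of all defined $\mathrm{Pat}(s,\Sigma_\sigma,n)$, $s\in\mathcal W_k$. For $\pi=\pi_1\cdots\pi_n\in\mathfrak S_n$, $\hat\pi$ is the cyclic permutation with cycle notation $(\pi_1,\pi_2,\dots,\pi_n)$,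 i.e. $\hat\pi_{\pi_i}=\pi_{i+1}$ with $\pi_{n+1}:=\pi_1$; $\hat\pi^*$ is the word obtained from the one-line notation $\hat\pi_1\cdots\hat\pi_n$ by replacing the entry equal to $\pi_1$ (located at position $\pi_n$) by the symbol $*$. A $*$-permutation of length $n$ is a word $\tau^*=\tau^*_1\cdots\tau^*_n$ obtained from a permutation of $[n]$ by replacing one entry by $*$; $\mathcal C_n^*$ is the set of $*$-permutations for which the permutation obtained by restoring the missing value is an $n$-cycle. A $*$-$\sigma$-segmentation of $\tau^*$ is a sequence $0=e_0\le e_1\le\cdots\le e_k=n$ such that: (a) for each $0\le t\le k-1$, the entries of $\tau^*_{e_t+1}\cdots\tau^*_{e_{t+1}}$ other than $*$ are increasing if $\sigma_t=+$ and decreasing if $\sigma_t=-$; (b) if $\sigma_0=+$ and $\tau^*_1\tau^*_2=*1$, then $e_1\le1$; (c) if $\sigma_{k-1}=+$ and $\tau^*_{n-1}\tau^*_n=n*$, then $e_{k-1}\ge n-1$; (d) if $\sigma_0=\sigma_{k-1}=-$, $\tau^*_1=n$ and $\tau^*_{n-1}\tau^*_n=1*$, then $e_1=0$ or $e_{k-1}\ge n-1$; (e) if $\sigma_0=\sigma_{k-1}=-$, $\tau^*_n=1$ and $\tau^*_1\tau^*_2=*n$, then $e_{k-1}=n$ or $e_1\le1$. $\mathcal C^{\sigma,*}$ is the set of $\tau^*\in\bigcup_n\mathcal C_n^*$ that admit a $*$-$\sigma$-segmentation. *)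

(* Defs.v *)
From mathcomp Require Import all_boot all_fingroup.

Set Implicit Arguments.
Unset Strict Implicit.
Unset Printing Implicit Defensive.

(* The paper indexes letters of words and entries of permutations from 1.
   Infinite words s_1 s_2 ... are functions on nat with s_(i+1) = s i.
   Finite words are sequences, read from position 1 by [entry]. *)

Definition entry (w : seq nat) (i : nat) : nat := nth 0 w i.-1.

(* One-line notation, with values in {1, ..., n}. *)
Definition one_line (n : nat) (p : 'S_n) : seq nat :=
  [seq (p i).+1 | i <- enum 'I_n].

(* [is_rho lt x w] means that rho(x_1, ..., x_n) = w, for lt a strict order
   and w a permutation of [n] in one-line notation. *)
Definition is_rho (T : Type) (lt : T -> T -> Prop) (n : nat)
    (x : n.-tuple T) (w : seq nat) : Prop :=
  perm_eq w (iota 1 n) /\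
  forall i j : 'I_n,
    lt (tnth x i) (tnth x j) <-> nth 0 w i < nth 0 w j.

(* In a signature, true stands for + and false for -. *)
Definition signature (k : nat) : predArgType := k.-tuple bool.

Definition word (k : nat) : Type := nat -> 'I_k.

Definition minus_count (k : nat) (sigma : signature k) (s : word k) (j : nat)
    : nat :=
  \sum_(i < j) ~~ tnth sigma (s i).

Definition prec (k : nat) (sigma : signature k) (s t : word k) : Prop :=
  exists j : nat,
    [/\ forall i : nat, i < j -> s i = t i,
        s j <> t j
      & if odd (minus_count sigma s j) then s j > t j else s j < t j].

Definition shift (k : nat) (s : word k) : word k := fun i => s i.+1.

(* Pat(s, Sigma_sigma, n) is defined and equal to pi. *)
Definition is_Pat (k : nat) (sigma : signature k) (n : nat) (s : word k)
    (pi : 'S_n) : Prop :=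
  (forall i j : 'I_n, i != j -> ~ iter i (@shift k) s =1 iter j (@shift k) s)
  /\ is_rho (prec sigma) [tuple iter i (@shift k) s | i < n] (one_line pi).

(* pi belongs to A_n(Sigma_sigma). *)
Definition allowed (k : nat) (sigma : signature k) (n : nat) (pi : 'S_n)
    : Prop :=
  exists s : word k, is_Pat sigma s pi.

Lemma hat_subproof (n : nat) (pi : 'S_n) :
  injective (fun x : 'I_n => pi (ordS ((pi^-1)%g x))).
Proof. by move=> x y /perm_inj /ordS_inj /perm_inj. Qed.

(* The cycle (pi_1, ..., pi_n); ordS is the cyclic successor on 'I_n. *)
Definition hat (n : nat) (pi : 'S_n) : 'S_n := perm (@hat_subproof n pi).

(* In words with a star, None is the star. *)
Definition star (v : nat) (w : seq nat) : seq (option nat) :=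
  [seq if x == v then None else Some x | x <- w].

Definition hat_star (n : nat) (pi : 'S_n) : seq (option nat) :=
  star (entry (one_line pi) 1) (one_line (hat pi)).

Definition is_full_cycle (n : nat) (p : 'S_n) : Prop :=
  porbits p = [set [set: 'I_n]].

Definition in_C_star (n : nat) (tau : seq (option nat)) : Prop :=
  exists (p : 'S_n) (v : nat),
    [/\ is_full_cycle p, v \in one_line p & tau = star v (one_line p)].

(* The factor tau_(a+1) ... tau_b with its star, if any, removed. *)
Definition block (tau : seq (option nat)) (a b : nat) : seq nat :=
  pmap id (take (b - a) (drop a tau)).

Definition starts_with (tau u : seq (option nat)) : Prop :=
  take (size u) tau = u.

Definition ends_with (tau u : seq (option nat)) : Prop :=
  size u <= size tau /\ drop (size tau - size u) tau = u.

Record segmentation (k : nat) (sigma : signature k) (tau : seq (option nat))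
    (e : seq nat) : Prop := Segmentation {
  seg_size : size e = k.+1;
  seg_first : nth 0 e 0 = 0;
  seg_last : nth 0 e k = size tau;
  seg_sorted : sorted leq e;
  seg_a : forall t : 'I_k,
    sorted (if tnth sigma t then ltn else gtn)
           (block tau (nth 0 e t) (nth 0 e t.+1));
  seg_b : nth true sigma 0 = true ->
    starts_with tau [:: None; Some 1] ->
    nth 0 e 1 <= 1;
  seg_c : nth true sigma k.-1 = true ->
    ends_with tau [:: Some (size tau); None] ->
    nth 0 e k.-1 >= size tau - 1;
  seg_d : nth true sigma 0 = false -> nth true sigma k.-1 = false ->
    starts_with tau [:: Some (size tau)] ->
    ends_with tau [:: Some 1; None] ->
    nth 0 e 1 = 0 \/ nth 0 e k.-1 >= size tau - 1;
  seg_e : nth true sigma 0 = false -> nth true sigma k.-1 = false ->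
    ends_with tau [:: Some 1] ->
    starts_with tau [:: None; Some (size tau)] ->
    nth 0 e k.-1 = size tau \/ nth 0 e 1 <= 1
}.

Definition in_C_sigma_star (k : nat) (sigma : signature k)
    (tau : seq (option nat)) : Prop :=
  (exists n : nat, in_C_star n tau) /\
  exists e : seq nat, segmentation sigma tau e.

(* The integers b excluded by condition (dagger) for a segmentation e. *)
Definition dagger_obstruction (k n : nat) (pi : 'S_n) (e : seq nat) (b : nat)
    : Prop :=
  let p := entry (one_line pi) in
  let x := [tuple p (n - 2 * b); p (n - b); p n] in
  [/\ b >= 1,
      n - 2 * b >= 1,
      is_rho (fun u v : nat => u < v) x [:: 3; 1; 2] \/
      is_rho (fun u v : nat => u < v) x [:: 1; 3; 2]
    & forall i t : nat, 1 <= i <= b -> t < k ->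
        (nth 0 e t < p (n - b - i) <= nth 0 e t.+1) <->
        (nth 0 e t < p (n - i) <= nth 0 e t.+1)].

Definition dagger (k : nat) (sigma : signature k) (n : nat) (pi : 'S_n)
    : Prop :=
  exists e : seq nat,
    segmentation sigma (hat_star pi) e /\
    ~ exists b : nat, dagger_obstruction k pi e b.

(* Main.v *)
Require Import Defs.
From mathcomp Require Import all_boot all_fingroup.
From mathcomp Require Import zify.
From Stdlib Require Import Classical_Prop.

Set Implicit Arguments.
Unset Strict Implicit.
Unset Printing Implicit Defensive.

(* Write [u_i = z_i ... z_(n-1)] for the itinerary of [pi_i, ..., pi_(n-1)] through
   the blocks of a segmentation. A word [z_1 ... z_(n-1) w] has pattern [pi] as soon
   as each [u_i w] lies on the same side of [w] as [pi_i] does of [pi_n]. For every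
   finite word [u], the words [u w] and [u^oo] lie on the same side of [w], so [w]
   must separate the powers [u_i^oo] with [pi_i < pi_n] from those with
   [pi_i > pi_n]. Extending the cycle weakly monotonically at the star yields a
   word [w0], the itinerary of [pi_n], which separates them weakly. If
   [w0 = u_i^oo], condition (dagger) keeps all powers equal to [w0] on one side, and
   [w0] is moved off them by replacing a long tail with a word [b] on the other
   side; conditions (b)-(e) say that [w0] is not an extreme word, so [b] exists.
   Conversely, the blocks of a realizing word are read off its first letters. *)

(** * Comparison of numbers in a direction [d], and least-element principles *)

Definition slt (d : bool) (a b : nat) : bool := if d then b < a else a < b.

Lemma sltC d a b : slt (~~ d) a b = slt d b a.
Proof. by case: d. Qed.

Lemma slt_trans d b a c : slt d a b -> slt d b c -> slt d a c.
Proof. by case: d; rewrite /slt; lia. Qed.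

Lemma slt_asym d a b : slt d a b -> ~~ slt d b a.
Proof. by case: d; rewrite /slt; lia. Qed.

Lemma sltnn d a : slt d a a = false.
Proof. by case: d; rewrite /slt; lia. Qed.

Lemma slt_total d a b : a <> b -> slt d a b \/ slt d b a.
Proof. by case: d; rewrite /slt; lia. Qed.

Lemma slt_dir a b : a <> b -> exists d, slt d a b.
Proof. by move=> ne; exists (b < a); rewrite /slt; case: ltnP; lia. Qed.

Lemma ex_least (A : nat -> Prop) :
  (exists n, A n) -> exists n, A n /\ forall m, m < n -> ~ A m.
Proof.
case=> n; elim/ltn_ind: n => n IHn An.
case: (classic (exists2 m, m < n & A m)) => [[m ltmn]|noA]; first exact: IHn.
by exists n; split=> // m ltmn Am; apply: noA; exists m.
Qed.

Lemma uniform_bound (n : nat) (A : nat -> nat -> Prop) :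
  (forall i, i < n -> exists m, A i m) ->
  exists M, forall i, i < n -> exists2 m, m < M & A i m.
Proof.
elim: n => [|n IHn] exA; first by exists 0.
have [M boundM] := IHn (fun i lt_in => exA i (ltnW lt_in)).
have [m Anm] := exA n (ltnSn n).
exists (maxn M m.+1) => i; rewrite ltnS leq_eqVlt => /orP[/eqP->|/boundM[j ltj Aij]].
  by exists m; rewrite // leq_maxr.
by exists j; rewrite // leq_max ltj.
Qed.

(** * The signed lexicographic order, and prefixes and powers of finite words *)

Section SignedOrder.

Variables (k : nat) (sigma : signature k).
Implicit Types (s t u w : word k) (d : bool) (i j l m : nat).

Definition neg (a : 'I_k) : bool := ~~ tnth sigma a.

Lemma negE a : neg a = ~~ tnth sigma a.
Proof. by []. Qed.

Definition parity s j : bool := odd (minus_count sigma s j).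

Lemma parity0 s : parity s 0 = false.
Proof. by rewrite /parity /minus_count big_ord0. Qed.

Lemma parityS s j : parity s j.+1 = parity s j (+) neg (s j).
Proof. by rewrite /parity /minus_count big_ord_recr /= oddD oddb. Qed.

Lemma eq_parity s t j :
  (forall i, i < j -> s i = t i) -> parity s j = parity t j.
Proof.
move=> eq_st; rewrite /parity /minus_count; congr (odd _).
by apply: eq_bigr => i _; rewrite eq_st.
Qed.

Lemma parityD s i j :
  parity s (i + j) = parity s i (+) parity (fun m => s (i + m)) j.
Proof.
elim: j => [|j IHj]; first by rewrite addn0 parity0 addbF.
by rewrite addnS !parityS IHj addbA.
Qed.

(* [wlt false] is the order [prec] and [wlt true] its converse. *)
Definition wlt d s t : Prop :=
  exists j, (forall i, i < j -> s i = t i) /\ slt (d (+) parity s j) (s j) (t j).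

Lemma precE s t : prec sigma s t <-> wlt false s t.
Proof.
split=> [[j [eq_st ne lt]]|[j [eq_st lt]]]; exists j.
  by split=> //; rewrite /slt /parity addFb; case: odd lt.
by split=> // eqj; rewrite eqj sltnn in lt.
Qed.

Lemma wltC d s t : wlt (~~ d) s t <-> wlt d t s.
Proof.
suff imp e x y : wlt (~~ e) x y -> wlt e y x.
  by split; [exact: imp|rewrite -{1}[d]negbK; exact: imp].
case=> j [eq_xy lt]; exists j; split=> [i /eq_xy->//|].
rewrite (@eq_parity y x); last by move=> i /eq_xy->.
by rewrite -sltC -addNb.
Qed.

Lemma eq_wlt d s s' t t' : s =1 s' -> t =1 t' -> wlt d s t -> wlt d s' t'.
Proof.
move=> eqs eqt [j [eq_st lt]]; exists j; split=> [i lij|].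
  by rewrite -eqs -eqt eq_st.
by rewrite -(@eq_parity s s') -?eqs -?eqt // => i _; rewrite eqs.
Qed.

Lemma eq_wltl d s s' t : s =1 s' -> wlt d s t -> wlt d s' t.
Proof. by move=> eqs; apply: eq_wlt. Qed.

Lemma eq_wltr d s t t' : t =1 t' -> wlt d s t -> wlt d s t'.
Proof. by move=> eqt; apply: eq_wlt. Qed.

Lemma wlt_neq d s t : wlt d s t -> ~ s =1 t.
Proof. by case=> j [_ lt] eq_st; rewrite eq_st sltnn in lt. Qed.

Lemma wlt_trans d t s u : wlt d s t -> wlt d t u -> wlt d s u.
Proof.
case=> i [eq_st lti] [j [eq_tu ltj]].
case: (ltngtP i j) => [lij|lji|eij].
- exists i; split=> [m lm|]; last by rewrite -eq_tu.
  by rewrite eq_st // eq_tu // (ltn_trans lm).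
- exists j; split=> [m lm|]; last first.
    by rewrite (@eq_parity s t) ?eq_st // => m lm; rewrite eq_st // (ltn_trans lm).
  by rewrite eq_st ?eq_tu // (ltn_trans lm).
- subst j; exists i; split=> [m lm|]; first by rewrite eq_st ?eq_tu.
  by apply: slt_trans lti _; rewrite (@eq_parity s t).
Qed.

Lemma wlt_asym d s t : wlt d s t -> ~ wlt d t s.
Proof. by move=> st ts; apply: (wlt_neq (wlt_trans st ts)). Qed.

Lemma wlt_total d s t : ~ s =1 t -> wlt d s t \/ wlt d t s.
Proof.
move=> ne; have /ex_least[j [nej minj]] : exists j, s j <> t j.
  by apply: NNPP => no; apply: ne => j; apply: NNPP => nej; apply: no; exists j.
have eq_st i : i < j -> s i = t i by move/minj/NNPP.
have [lt|lt] := @slt_total (d (+) parity s j) (s j) (t j) (fun e => nej (val_inj e)).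
  by left; exists j.
right; exists j; split=> [i /eq_st->//|].
by rewrite (@eq_parity t s) // => i /eq_st->.
Qed.

Lemma wlt_head d s t : slt d (s 0) (t 0) -> wlt d s t.
Proof. by move=> lt; exists 0; rewrite parity0 addbF. Qed.

Lemma wlt_shift d s t :
  s 0 = t 0 -> wlt d s t <-> wlt (d (+) neg (s 0)) (shift s) (shift t).
Proof.
have parity_shift j : parity s j.+1 = neg (s 0) (+) parity (shift s) j.
  by rewrite -add1n parityD parityS parity0.
move=> eq0; split=> [[[|j] [eq_st lt]]|[j [eq_st lt]]].
- by rewrite eq0 sltnn in lt.
- exists j; split=> [i lij|]; first exact: (eq_st i.+1).
  by rewrite -addbA -parity_shift.
- exists j.+1; split=> [[|i] // lij|]; first exact: (eq_st i).
  by rewrite parity_shift addbA.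
Qed.

(** A finite word is encoded by its length [l] and an infinite word [u] that extends it. In this
    encoding [glue l u w] is the product [u w] and [per l u] is the power [u^oo]. *)
Definition glue l u w : word k := fun m => if m < l then u m else w (m - l).

Definition per l u : word k := fun m => u (m %% l).

(* Up to and including the first place where [w] differs from [u^oo], the words
   [u w] and [u^oo] coincide; hence they compare to [w] in the same way. *)
Lemma wlt_per_glue d l u w : 0 < l -> wlt d (per l u) w -> wlt d (glue l u w) w.
Proof.
move=> l0 [j [eq_pw lt]].
have E i : i <= j -> glue l u w i = per l u i.
  move=> lij; rewrite /glue; case: ltnP => [il|li]; first by rewrite /per modn_small.
  by rewrite -eq_pw; [rewrite /per -{2}(subnK li) modnDr|lia].
exists j; split=> [i lij|]; first by rewrite E ?eq_pw // ltnW.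
by rewrite E // (@eq_parity _ (per l u)) // => i lij; rewrite E // ltnW.
Qed.

Lemma wlt_per_glue_r d l u w : 0 < l -> wlt d w (per l u) -> wlt d w (glue l u w).
Proof. by move=> l0 /wltC lt; apply/wltC; apply: wlt_per_glue. Qed.

Lemma glue_per l u w : 0 < l -> w =1 per l u -> glue l u w =1 w.
Proof.
move=> l0 eqw m; rewrite /glue !eqw /per; case: ltnP => [ml|lm].
  by rewrite modn_small.
by rewrite -{2}(subnK lm) modnDr.
Qed.

(** By totality only [u^oo = w] and the opposite inequality have to be excluded: the first would
    give [u w = w], and the second passes to [u w] by [wlt_per_glue_r]. *)
Lemma wlt_glue_perE d l u w :
  0 < l -> wlt d (glue l u w) w -> wlt d (per l u) w.
Proof.
move=> l0 lt; case: (classic (per l u =1 w)) => [eqw|ne].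
  by case: (wlt_neq lt); apply: glue_per => // m; rewrite eqw.
case: (wlt_total d ne) => // /wlt_per_glue_r - /(_ l0) gt.
by case: (wlt_asym lt gt).
Qed.

Lemma wlt_glue_perE_r d l u w :
  0 < l -> wlt d w (glue l u w) -> wlt d w (per l u).
Proof. by move=> l0 /wltC lt; apply/wltC; apply: wlt_glue_perE. Qed.

Definition tail i s : word k := fun m => s (i + m).

Lemma iter_shift i s : iter i (@shift k) s =1 tail i s.
Proof.
elim: i s => [|i IHi] s m //; rewrite iterSr IHi.
by rewrite /tail /shift addSn.
Qed.

(* The prefix of length [2 l] has even parity, so prepending it to both
   sides of [s < b] preserves the order. *)
Lemma wlt_glue_periodic d l s b :
  (forall m, s (l + m) = s m) -> wlt d s b -> wlt d s (glue (2 * l) s b).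
Proof.
move=> s_l [j [eq_sb lt]].
have s_2l m : s (2 * l + m) = s m by rewrite mulSn mul1n -addnA !s_l.
have even2l : parity s (2 * l) = false.
  rewrite mulSn mul1n parityD (@eq_parity _ s) ?addbb // => m _; exact: s_l.
have glue_l m : glue (2 * l) s b (2 * l + m) = b m.
  by rewrite /glue ltnNge leq_addr /= addKn.
exists (2 * l + j); split.
  move=> i; case: (ltnP i (2 * l)) => [il _|li lij]; first by rewrite /glue il.
  by rewrite -(subnKC li) glue_l s_2l eq_sb //; lia.
by rewrite parityD even2l addFb glue_l s_2l (@eq_parity _ s).
Qed.

End SignedOrder.

(** * Least and greatest words of the signed order *)

Section ExtremeWords.

Variables (K : nat) (sigma : signature K.+1).
Implicit Types (d : bool) (s w : word K.+1).

Definition extreme_letter d : 'I_K.+1 := if d then ord_max else ord0.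

(** The direction in which letters are compared after the first [j] letters of the extreme word;
    each negative letter flips it, and the next letter is chosen extreme for it. *)
Fixpoint extreme_side d j : bool :=
  if j is i.+1
  then extreme_side d i (+) neg sigma (extreme_letter (extreme_side d i))
  else d.

(* The least word if [d = false], the greatest if [d = true]. *)
Definition extreme_word d : word K.+1 :=
  fun j => extreme_letter (extreme_side d j).

Lemma extreme_sideE d j :
  extreme_side d j = d (+) parity sigma (extreme_word d) j.
Proof.
elim: j => [|j IHj]; first by rewrite parity0 addbF.
by rewrite parityS addbA -IHj.
Qed.

Lemma extreme_wordP d s : ~ wlt sigma d s (extreme_word d).
Proof.
case=> j [eq_s]; rewrite (eq_parity sigma eq_s) -extreme_sideE /extreme_word.
case: extreme_side => /=; last by [].
by rewrite ltnNge -ltnS ltn_ord.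
Qed.

(** The signs of the two extreme letters leave three shapes for an extreme word: constant,
    alternating, or one letter followed by a constant word. This lemma and the next two treat them
    in turn. *)
Lemma extreme_word_const d j :
  ~~ neg sigma (extreme_letter d) -> extreme_word d j = extreme_letter d.
Proof.
move=> pos; congr extreme_letter; elim: j => //= j ->.
by rewrite (negbTE pos) addbF.
Qed.

Lemma extreme_word_alt d j :
  neg sigma (extreme_letter d) -> neg sigma (extreme_letter (~~ d)) ->
  extreme_word d j = extreme_letter (d (+) odd j).
Proof.
move=> n1 n2; congr extreme_letter; elim: j => [|j /= ->]; first by rewrite addbF.
suff -> : neg sigma (extreme_letter (d (+) odd j)) by rewrite addbT addbN.
by case: (odd j); rewrite ?addbF ?addbT.
Qed.

Lemma extreme_word_eventually d j :
  neg sigma (extreme_letter d) -> ~~ neg sigma (extreme_letter (~~ d)) ->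
  extreme_word d j.+1 = extreme_letter (~~ d).
Proof.
move=> n1 n2; congr extreme_letter.
elim: j => [|j IHj]; first by rewrite /= n1 addbT.
have -> : extreme_side d j.+2 = extreme_side d j.+1 (+)
  neg sigma (extreme_letter (extreme_side d j.+1)) by [].
by rewrite IHj (negbTE n2) addbF.
Qed.

(** Replacing [u w] by [u^oo] would put [w] strictly beyond the extreme word. This is the source of
    the necessity of conditions (b)-(e). *)
Lemma not_wlt_glue_extreme d l u w :
  0 < l -> per l u =1 extreme_word d -> ~ wlt sigma d w (glue l u w).
Proof.
move=> l0 eq_ext /(wlt_glue_perE_r l0) lt.
by apply: (@extreme_wordP d w); apply: eq_wlt lt.
Qed.

End ExtremeWords.

(** * Realizing a pattern by a word, given the block of each position *)

Section Realization.

(** Indices and values are counted from 0: [k = K + 1], [n = N + 1] and [P i] stands for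
    [pi_(i+1) - 1]. The hypotheses make [P] a permutation of [0, ..., N], and the star is at
    position [P N]. *)
Variables (K : nat) (sigma : signature K.+1) (N : nat) (P : nat -> nat).
Hypothesis P_inj : forall i j, i <= N -> j <= N -> P i = P j -> i = j.
Hypothesis P_le : forall i, i <= N -> P i <= N.
Hypothesis P_surj : forall v, v <= N -> exists2 i, i <= N & P i = v.

Local Notation neg := (neg sigma).
Local Notation wlt := (wlt sigma).
Local Notation parity := (parity sigma).
Implicit Types (s w : word K.+1) (cls : nat -> 'I_K.+1).

Definition extreme_value d := if d then N else 0.

(* Conditions (a)-(e) of a segmentation, in terms of the map [cls] sending a
   position to the index of its block. *)
Record compatible cls : Prop := Compatible {
  cls_mono : forall a b, a <= b -> b <= N -> cls a <= cls b;
  next_mono : forall d i j, i < N -> j < N -> cls (P i) = cls (P j) ->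
    slt d (P i) (P j) -> slt (d (+) neg (cls (P i))) (P i.+1) (P j.+1);
  extreme_not_fixed : forall d, 0 < N -> ~~ neg (extreme_letter K d) ->
    P N = extreme_value d -> cls (P N.-1) <> extreme_letter K d;
  extreme_not_swapped : forall d, 1 < N ->
    neg (extreme_letter K d) -> neg (extreme_letter K (~~ d)) ->
    P N = extreme_value d -> cls (P N.-1) = extreme_letter K (~~ d) ->
    cls (P N.-2) <> extreme_letter K d
}.

(** The patterns 312 and 132 together say that [pi_n] lies strictly between [pi_(n-2b)] and
    [pi_(n-b)], hence the inequality between two booleans. *)
Definition obstructed cls b : Prop :=
  [/\ 0 < b, 2 * b <= N, (P (N - 2 * b) < P N) != (P (N - b) < P N)
    & forall i, 0 < i <= b -> cls (P (N - b - i)) = cls (P (N - i))].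

Definition realizes s : Prop :=
  forall d i j, i <= N -> j <= N -> slt d (P i) (P j) ->
  wlt d (tail i s) (tail j s).

Lemma P_neq i j : i <= N -> j <= N -> i <> j -> P i <> P j.
Proof. by move=> iN jN ne /P_inj - /(_ iN jN). Qed.

Lemma realizes_reflect s d i j :
  realizes s -> i <= N -> j <= N ->
  wlt d (tail i s) (tail j s) -> slt d (P i) (P j).
Proof.
move=> real iN jN lt; have [eij|neij] := eqVneq i j.
  by subst j; case: (wlt_neq lt).
have [//|/real gt] := slt_total d (P_neq iN jN (elimN eqP neij)).
by case: (wlt_asym lt); apply: gt.
Qed.

(** Puts a tail of [s] in the form [u w] with [w = tail N s], so that comparing it with [w] amounts
    to comparing [u^oo] with [w]. *)
Lemma glue_tail s l : l <= N ->
  glue l (tail (N - l) s) (tail N s) =1 tail (N - l) s.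
Proof.
move=> lN m; rewrite /glue /tail; case: ltnP => // lm.
by congr s; lia.
Qed.

Lemma slt_extreme d i : i < N -> P N = extreme_value d -> slt d (P N) (P i).
Proof.
move=> iN PN; have := P_neq (ltnW iN) (leqnn N) ltac:(lia).
by have := P_le (ltnW iN); rewrite PN /slt /extreme_value; case: d {PN}; lia.
Qed.

Definition near_extreme_value d := if d then N.-1 else 1.

(** A position [v] strictly on the outer side of [P i] would lie in the same extreme block, and
    since the cycle is monotone on that block it would send [v] beyond the extreme value. This
    locates the predecessor of an extreme value. *)
Lemma extreme_preimage cls c v i :
  (forall a b, a <= b -> b <= N -> cls a <= cls b) ->
  (forall d i j, i < N -> j < N -> cls (P i) = cls (P j) ->
    slt d (P i) (P j) -> slt (d (+) neg (cls (P i))) (P i.+1) (P j.+1)) ->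
  i < N -> v <= N -> v <> P N -> ~ slt c (P i) v ->
  cls (P i) = extreme_letter K c ->
  P i.+1 = extreme_value (c (+) neg (extreme_letter K c)) -> P i = v.
Proof.
move=> mono next iN vN vPN nlt clsi Pi1.
have [//|/eqP ne] := eqVneq (P i) v.
have gt : slt c v (P i) by have [] := slt_total c ne.
have [j jN Pj] := P_surj vN; subst v.
have {}jN : j < N by rewrite ltn_neqAle jN andbT; apply/eqP => E; rewrite E in vPN.
have clsj : cls (P j) = extreme_letter K c.
  apply/val_inj/eqP; rewrite eqn_leq /=.
  move: gt (mono (P i) (P j)) (mono (P j) (P i)) (P_le (ltnW iN)) (P_le (ltnW jN)).
  rewrite clsi /slt; case: (c) => /= gt m1 m2 Pi Pj.
    by rewrite m1 ?(ltnW gt) // andbT -ltnS ltn_ord.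
  by rewrite m2 ?(ltnW gt).
have := next c j i jN iN; rewrite clsi clsj => /(_ erefl gt).
rewrite Pi1; move: (P_le jN); rewrite /slt /extreme_value.
by case: (_ (+) _); lia.
Qed.

(** * Necessity: the first letters of a realizing word satisfy all conditions *)

Section Necessity.

Variables (s : word K.+1) (cls : nat -> 'I_K.+1).
Hypothesis s_real : realizes s.
Hypothesis s_cls : forall i, i <= N -> cls (P i) = s i.

Lemma realizes_compatible : compatible cls.
Proof.
split=> [a b|d i j iN jN|d N0 pos PN clsN|d N1 n1 n2 PN clsN1 clsN2].
- rewrite leq_eqVlt => /orP[/eqP->//|ltab] bN.
  have [i iN Ei] := P_surj (ltnW (leq_trans ltab bN)).
  have [j jN Ej] := P_surj bN.
  subst a b; rewrite !s_cls // leqNgt; apply/negP => lt_ji.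
  have gt : wlt true (tail i s) (tail j s).
    by apply: wlt_head; rewrite /slt /tail !addn0.
  have := @s_real false i j iN jN ltab.
  by apply/wlt_asym; apply/wltC.
- rewrite !s_cls; try exact: ltnW.
  move=> eq_s lt; apply: (realizes_reflect s_real) => //.
  have := s_real (ltnW iN) (ltnW jN) lt.
  rewrite wlt_shift /tail ?addn0 //; apply: eq_wlt => m.
    by rewrite /shift /= addSnnS.
  by rewrite /shift /= addSnnS.
(* Here [u] is the single letter at [N - 1]. If it were the positive extreme letter, [u^oo] would be
   the extreme word. *)
- have := s_real (leqnn N) (leq_subr 1 N) (slt_extreme (i := N - 1) ltac:(lia) PN).
  move/(eq_wltr (fsym (glue_tail s N0))).
  apply: (@not_wlt_glue_extreme _ _ _ 1) => // m.
  rewrite extreme_word_const // /per modn1 /tail addn0 -clsN s_cls ?leq_pred //.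
  by rewrite subn1.
(* Same argument with period 2: the two letters before the star position would repeat to the
   alternating extreme word. *)
- have := s_real (leqnn N) (leq_subr 2 N) (slt_extreme (i := N - 2) ltac:(lia) PN).
  move/(eq_wltr (fsym (glue_tail s N1))).
  apply: (@not_wlt_glue_extreme _ _ _ 2) => // m.
  rewrite extreme_word_alt // /per modn2 /tail; case: (odd m) => /=.
    rewrite addbT -clsN1 s_cls ?leq_pred //; congr s; lia.
  rewrite addn0 addbF -clsN2 -subn2 s_cls //; lia.
Qed.

(** Equality of the letters makes the last [2 * b] letters before the star position the square of
    the last [b]. Both blocks then have the same power, so the two tails lie on the same side of
    [tail N s]. *)
Lemma realizes_unobstructed b : ~ obstructed cls b.
Proof.
case=> b0 b2N side eq_cls.
have bN : b <= N by lia.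
have eq_per : per (2 * b) (tail (N - 2 * b) s) =1 per b (tail (N - b) s).
  move=> m; rewrite /per /tail -(modn_dvdm m (dvdn_mull 2 (dvdnn b))).
  have : m %% (2 * b) < 2 * b by rewrite ltn_mod; lia.
  move: (m %% (2 * b)) => r r2b; case: (ltnP r b) => [rb|br].
    have := eq_cls (b - r) ltac:(lia); rewrite modn_small // !s_cls; try lia.
    by move=> e; apply: etrans (etrans e _); congr s; lia.
  have -> : r %% b = r - b by rewrite -{1}(subnK br) modnDr modn_small //; lia.
  by congr s; lia.
have [d lt] := slt_dir (P_neq (leq_subr b N) (leqnn N) ltac:(lia)).
have := s_real (leq_subr b N) (leqnn N) lt.
move/(eq_wltl (fsym (glue_tail s bN))).
move/(wlt_glue_perE b0)/(eq_wltl (fsym eq_per)).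
move/(wlt_per_glue (ltac:(lia) : 0 < 2 * b)).
move/(eq_wltl (glue_tail s b2N)).
move/(realizes_reflect s_real (leq_subr _ _) (leqnn N)) => lt2.
by move: side lt lt2; rewrite /slt; case: d; lia.
Qed.

End Necessity.

(** * Sufficiency: construction of a realizing word *)

Section Sufficiency.

Variable cls : nat -> 'I_K.+1.
Hypothesis cls_ok : compatible cls.
Hypothesis cls_free : forall b, ~ obstructed cls b.

Let z : word K.+1 := fun i => cls (P i).

(** With indices from 1 this is [u_(i+1)^oo]. *)
Let power i : word K.+1 := per (N - i) (tail i z).

Let next_slt d i j : i < N -> j < N -> z i = z j ->
  slt d (P i) (P j) = slt (d (+) neg (z i)) (P i.+1) (P j.+1).
Proof.
move=> iN jN eqz; apply/idP/idP; first exact: (next_mono cls_ok).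
have [<-|ne] := eqVneq i j; first by rewrite sltnn.
have [//|/(next_mono cls_ok)] := slt_total d (P_neq (ltnW iN) (ltnW jN) (elimN eqP ne)).
by rewrite -/(z j) -eqz => /(_ jN iN erefl) /slt_asym/negP.
Qed.

Let slt_iterate d i j l : i + l <= N -> j + l <= N ->
  (forall m, m < l -> z (i + m) = z (j + m)) ->
  slt d (P i) (P j) = slt (d (+) parity (tail i z) l) (P (i + l)) (P (j + l)).
Proof.
elim: l => [|l IHl] iN jN eqz; first by rewrite parity0 addbF !addn0.
rewrite IHl; try lia; last by move=> m ml; apply: eqz; lia.
by rewrite next_slt ?addnS ?parityS ?addbA //; try lia; apply: eqz.
Qed.

(* The value at the star need not be new: the largest value forced from below
   already makes [f] weakly monotone on every block. *)
Lemma weak_extension : exists f : nat -> nat,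
  [/\ forall a, a <= N -> f a <= N,
      forall i, i < N -> f (P i) = P i.+1
    & forall d a b, a <= N -> b <= N -> cls a = cls b ->
        slt (d (+) neg (cls a)) (f a) (f b) -> slt d a b].
Proof.
pose g := neg (z N).
(* The condition selects the positions in the block of the star whose images must not exceed the
   image of the star. An empty maximum gives 0, which then violates no bound. *)
pose v0 := \max_(i < N | (z i == z N) && slt g (P i) (P N)) P i.+1.
pose f a := if [pick i : 'I_N | P i == a] is Some i then P i.+1 else v0.
have fP i : i < N -> f (P i) = P i.+1.
  move=> iN; rewrite /f; case: pickP => [j /eqP/P_inj|/(_ (Ordinal iN))].
    by move=> ->//; apply: ltnW.
  by rewrite eqxx.
have fN : f (P N) = v0.
  rewrite /f; case: pickP => // j /eqP/P_inj E.
  by have := ltn_ord j; rewrite E ?ltnn // ltnW.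
have v0_ge i : i < N -> z i = z N -> slt g (P i) (P N) -> P i.+1 <= v0.
  move=> iN ez lt; apply: (@leq_bigmax_cond _ _ (fun i : 'I_N => P i.+1) (Ordinal iN)).
  by rewrite /= ez eqxx.
have v0_le i : i < N -> z i = z N -> slt g (P N) (P i) -> v0 <= P i.+1.
  move=> iN ez lt; apply/bigmax_leqP => j /andP[/eqP ezj ltj].
  have := slt_trans ltj lt; rewrite next_slt ?ezj // -/g addbb.
  exact: ltnW.
exists f; split=> // [a aN|d a b aN bN].
  rewrite /f; case: pickP => [i _|_]; first exact: P_le.
  by apply/bigmax_leqP => i _; apply: P_le.
have [i iN <-] := P_surj aN; have [j jN <-] := P_surj bN.
rewrite -/(z i) -/(z j) => ez.
have [<-|ne] := eqVneq i j; first by rewrite sltnn.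
have [//|lt] := slt_total d (P_neq iN jN (elimN eqP ne)).
move: iN jN; rewrite (leq_eqVlt i) (leq_eqVlt j) => /orP[/eqP eN|iN] /orP[/eqP e'N|jN].
- by rewrite eN e'N eqxx in ne.
- subst i; rewrite fN fP // -/g; move: lt (v0_ge _ jN (esym ez)) (v0_le _ jN (esym ez)).
  by rewrite /slt; case: (d); case: (g) => /= lt h1 h2; lia.
- subst j; rewrite fN fP // ez -/g; move: lt (v0_ge _ iN ez) (v0_le _ iN ez).
  by rewrite /slt; case: (d); case: (g) => /= lt h1 h2; lia.
- rewrite !fP // => lt'; move: lt; rewrite next_slt // -ez => /slt_asym/negP[].
  exact: lt'.
Qed.

(** The itinerary of [P N] under the weak extension serves: a weakly monotone map cannot reverse the
    strict order of two itineraries, and the itinerary of [P i] is the prefix up to the star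
    followed by that of [P N]. *)
Lemma weak_word : exists w, forall d i,
  i < N -> slt d (P i) (P N) -> ~ wlt d w (power i).
Proof.
have [f [f_le fP f_mono]] := weak_extension.
pose itin a : word K.+1 := fun m => cls (iter m f a).
have iter_le m a : a <= N -> iter m f a <= N by elim: m => //= m IHm /IHm/f_le.
have itin_mono j : forall d a b, a <= N -> b <= N ->
    (forall i, i < j -> itin a i = itin b i) ->
    slt (d (+) parity (itin a) j) (itin a j) (itin b j) -> slt d a b.
  elim: j => [|j IHj] d a b aN bN eq_ab lt.
    move: lt; rewrite parity0 addbF /itin /=.
    have := @cls_mono _ cls_ok a b; have := @cls_mono _ cls_ok b a.
    by rewrite /slt; case: d => mab mba lt; rewrite ltnNge; apply/negP => le;
       [have := mba le bN|have := mab le aN]; lia.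
  apply: f_mono (eq_ab 0 (ltn0Sn j)) _ => //.
  have itinS c m : itin c m.+1 = itin (f c) m by rewrite /itin iterSr.
  apply: IHj; [exact: f_le|exact: f_le|move=> i ij|].
    by rewrite -!itinS eq_ab.
  have := parityD sigma (itin a) 1 j; rewrite parityS parity0 add1n addFb => E.
  move: lt; rewrite E !itinS addbA; congr (slt (_ (+) _) _ _).
  by apply: eq_parity => m _; rewrite add1n itinS.
have itinP l : forall i, i + l = N -> itin (P i) =1 glue l (tail i z) (itin (P N)).
  elim: l => [|l IHl] i iN m; first by rewrite /glue subn0 -iN addn0.
  case: m => [|m]; first by rewrite /glue /tail addn0.
  rewrite /itin iterSr fP; last by lia.
  by rewrite [LHS](IHl i.+1 _ m) /glue /tail ?addSnnS //; lia.
exists (itin (P N)) => d i iN lt.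
move/(wlt_per_glue_r (ltac:(lia) : 0 < N - i)).
move/(eq_wltr (fsym (itinP (N - i) i ltac:(lia)))) => -[j [eqj ltj]].
have := itin_mono j d _ _ (P_le (leqnn N)) (P_le (ltnW iN)) eqj ltj.
by apply/negP; apply: slt_asym.
Qed.

(* Two equal powers have exponents that are multiples of the least one [g];
   the absence of an obstruction at [b = g] then propagates to all of them. *)
Lemma power_same_side d i j : i < N -> j < N -> power i =1 power j ->
  slt d (P i) (P N) -> slt d (P j) (P N).
Proof.
move=> iN jN eq_ij.
pose x := power i.
(* The lengths [p] such that the last [p] letters before the star position have power [x]. *)
pose G p := 0 < p <= N /\ power (N - p) =1 x.
have Gz p : G p -> forall m, m < p -> z (N - p + m) = x m.
  case=> pN eqx m mp; rewrite -eqx /power /per /tail modn_small //; lia.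
have Gper p : G p -> forall m, x (m + p) = x m.
  case=> pN eqx m; rewrite -!eqx /power /per /tail.
  by have -> : N - (N - p) = p; [lia|rewrite modnDr].
have GI p : 0 < p <= N -> (forall m, m < p -> z (N - p + m) = x m) ->
    (forall m, x (m + p) = x m) -> G p.
  move=> pN zx perx; split=> // m; rewrite /power /per /tail.
  have -> : N - (N - p) = p by lia.
  rewrite zx ?ltn_mod; last by lia.
  rewrite [in RHS](divn_eq m p); elim: (m %/ p) => [|q IHq]; first by [].
  by rewrite mulSn -addnA addnC perx.
have GB p q : G p -> G q -> q < p -> G (p - q).
  move=> Gp Gq qp; have [pN _] := Gp; have [qN _] := Gq.
  apply: GI => [|m mpq|m]; first by lia.
    have -> : N - (p - q) + m = N - p + (m + q) by lia.
    by rewrite Gz ?(Gper q) //; lia.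
  by rewrite -(Gper q) // -addnA subnK ?(Gper p) // ltnW.
have Gi : G (N - i) by split; [lia|rewrite subKn // ltnW].
have Gj : G (N - j) by split; [lia|rewrite subKn ?(ltnW jN) // => m; rewrite -eq_ij].
have [g [Gg g_min]] : exists g, G g /\ forall m, m < g -> ~ G m.
  by apply: ex_least; exists (N - i).
have [/andP[g0 gN] _] := Gg.
pose A p := P (N - p).
(* Going [g] steps back from the positions [A (p - g)] and [A (q - g)] crosses the same [g] letters,
   so the comparison changes only by the parity of one period. *)
have A_step e p q : G p -> G q -> g <= p -> g <= q ->
    slt e (A (p - g)) (A (q - g)) -> slt (e (+) parity x g) (A p) (A q).
  move=> Gp Gq gp gq; have [pN _] := Gp; have [qN _] := Gq.
  rewrite (@slt_iterate _ (N - p) (N - q) g); try lia.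
    rewrite (@eq_parity _ _ _ x) ?addbK; last by move=> m mg; rewrite /tail Gz //; lia.
    by congr (slt _ (P _) (P _)); lia.
  by move=> m mg; rewrite !Gz //; lia.
have [e Hg] : exists e, slt e (A g) (P N).
  by apply: slt_dir; apply: P_neq => //; lia.
have A0 : A 0 = P N by rewrite /A subn0.
have A_side p : G p -> slt e (A p) (P N).
  move=> Gp; have H2g : 2 * g <= p -> G (2 * g) /\ slt e (A (2 * g)) (P N).
    move=> g2p; have [pN _] := Gp.
    have G2g : G (2 * g).
      apply: GI => [|m m2g|m]; first by lia.
        have -> : N - 2 * g + m = N - p + (m + (p - 2 * g)) by lia.
        rewrite Gz //; last by lia.
        rewrite -[RHS](Gper p) // -[LHS](Gper g) // -[LHS](Gper g) //; congr x; lia.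
      by rewrite mul2n -addnn addnA !(Gper g).
    split=> //; case: (boolP (slt e (A (2 * g)) (P N))) => // nlt.
    case: (@cls_free g); split=> //; first by lia.
      have [] := slt_total e (@P_neq (N - 2 * g) N _ _ _); try lia.
        by rewrite -/(A _) (negbTE nlt).
      by move: Hg; rewrite /A /slt; case: (e); lia.
    move=> m mg; have := Gz _ G2g (g - m) ltac:(lia).
    rewrite -(Gz _ Gg); last by lia.
    by move=> E; apply: etrans (etrans _ E) _; congr (cls (P _)); lia.
  (* Invariant along the multiples of [g], in direction [e]: if a period reverses the order, [A p]
     stays between [A g] and [P N]; if it preserves the order, [A p] never passes [A g] towards
     [P N]. *)
  have: if parity x g then (A p = A g \/ slt e (A g) (A p)) /\ slt e (A p) (P N)
        else A p = A g \/ slt e (A p) (A g).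
    elim/ltn_ind: p Gp H2g => p IHp Gp H2g.
    have [->|ne_pg] := eqVneq p g; first by case: parity; auto.
    have gp : g < p by rewrite ltn_neqAle eq_sym ne_pg leqNgt; apply/negP => /g_min.
    have Gpg := GB _ _ Gp Gg gp.
    have g2p : g <= p - g by rewrite leqNgt; apply/negP => /g_min.
    have [G2g H2] := H2g ltac:(lia).
    have := IHp (p - g) ltac:(lia) Gpg (fun le => H2g ltac:(lia)).
    have e2g : 2 * g - g = g by lia.
    have S1 := @A_step _ (2 * g) g G2g Gg ltac:(lia) ltac:(lia).
    have S2 := @A_step _ p g Gp Gg ltac:(lia) ltac:(lia).
    have S3 := @A_step _ p (2 * g) Gp G2g ltac:(lia) ltac:(lia).
    have S4 := @A_step _ (2 * g) p G2g Gp ltac:(lia) ltac:(lia).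
    have eqA : A (p - g) = A g -> A p = A (2 * g).
      have [pN _] := Gp; move=> /P_inj E; congr A.
      suff : N - (p - g) = N - g by lia.
      by apply: E; lia.
    move: S1 S2 S3 S4; rewrite e2g subnn A0.
    case: (parity x g) => S1 S2 S3 S4.
      case=> pos lt; have lt1 := S2 _ lt; rewrite addbT sltC in lt1.
      split; first by right.
      case: pos => [/eqA->//|/S4]; rewrite addbT sltC => lt2.
      exact: slt_trans lt2 H2.
    have lt1 := S1 _ Hg; rewrite addbF in lt1.
    case=> [/eqA->|/S3]; first by right.
    by rewrite addbF => lt2; right; apply: slt_trans lt2 lt1.
  by case: parity => [[]//|[->//|lt]]; apply: slt_trans lt Hg.
have := A_side _ Gi; have := A_side _ Gj; rewrite /A !subKn ?(ltnW iN) ?(ltnW jN) //.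
by rewrite /slt; case: (d); case: (e); lia.
Qed.

(** A constant extreme word is excluded by [extreme_not_fixed]. An alternating one has even period,
    so its last two letters are excluded by [extreme_not_swapped]. The third shape is not periodic,
    because [0 < K] makes the two extreme letters distinct. *)
Lemma power_not_extreme d i : 0 < K -> i < N -> P N = extreme_value d ->
  ~ power i =1 extreme_word sigma d.
Proof.
move=> K0 iN PN eq_ext.
have z_ext m : 0 < m <= N - i -> z (N - m) = extreme_word sigma d (N - i - m).
  move=> mN; rewrite -eq_ext /power /per /tail modn_small; last by lia.
  by congr z; lia.
have ext_per : extreme_word sigma d (N - i) = extreme_letter K d.
  by rewrite -eq_ext /power /per modnn -[RHS](eq_ext 0) /power /per mod0n.
have ne_ext : extreme_letter K d <> extreme_letter K (~~ d).
  by case: (d) => /(congr1 val) /=; lia.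
have [n1|pos] := boolP (neg (extreme_letter K d)); last first.
  apply: (extreme_not_fixed cls_ok _ pos PN); first by lia.
  by rewrite -subn1 [LHS](z_ext 1) ?extreme_word_const //; lia.
have [n2|pos] := boolP (neg (extreme_letter K (~~ d))); last first.
  have E : N - i = (N - i).-1.+1 by lia.
  by apply: ne_ext; rewrite -ext_per E extreme_word_eventually.
have even : ~~ odd (N - i).
  apply/negP => od; apply: ne_ext; rewrite -ext_per extreme_word_alt //.
  by rewrite od addbT.
have Ni2 : 2 <= N - i by case: (N - i) even (subn_gt0 i N) => [|[]] //; rewrite iN.
apply: (extreme_not_swapped cls_ok _ n1 n2 PN); first by lia.
  rewrite -subn1 [LHS](z_ext 1) ?extreme_word_alt //; last by lia.
  by rewrite oddB ?(negbTE even) ?addbT //; lia.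
rewrite -subn2 [LHS](z_ext 2) ?extreme_word_alt //.
by rewrite oddB ?(negbTE even) ?addbF //; lia.
Qed.

Lemma strict_word : 0 < K -> exists w, forall d i,
  i < N -> slt d (P i) (P N) -> wlt d (power i) w.
Proof.
move=> K0; have [w0 w0_weak] := weak_word.
have side i : i < N -> exists d, slt d (P i) (P N).
  by move=> iN; apply: slt_dir; apply: P_neq => //; lia.
have w0_strict d i : i < N -> slt d (P i) (P N) -> ~ power i =1 w0 ->
    wlt d (power i) w0.
  by move=> iN lt ne; case: (wlt_total sigma d ne) => // /w0_weak[].
case: (classic (exists2 i, i < N & power i =1 w0)) => [[i0 i0N eq0]|ne]; last first.
  by exists w0 => d i iN lt; apply: w0_strict => // eqi; apply: ne; exists i.
have [d lt0] := side i0 i0N.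
have w0_below j : j < N -> slt d (P N) (P j) -> wlt d w0 (power j).
  move=> jN ltj; apply/wltC; apply: w0_strict => //; first by rewrite sltC.
  move=> eqj; have : slt d (P j) (P N).
    by apply: (power_same_side i0N jN) => // m; rewrite eq0 eqj.
  by apply/negP; apply: slt_asym.
(* If some [P j] lies on the other side of [P N], its power serves as [b]. Otherwise [P N] is an
   extreme value, and the extreme word serves, as it differs from the power [w0]. *)
have [b ltb] : exists b, wlt d w0 b.
  case: (classic (exists2 j, j < N & slt d (P N) (P j))) => [[j jN ltj]|no].
    by exists (power j); apply: w0_below.
  exists (extreme_word sigma (~~ d)); apply/wltC.
  have PN : P N = extreme_value (~~ d).
    have [j jN Pj] := @P_surj (extreme_value (~~ d)) ltac:(by case: (d)).
    move: jN; rewrite leq_eqVlt => /orP[/eqP ejN|jN]; first by rewrite -Pj ejN.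
    case: no; exists j => //; have := P_le (leqnn N).
    have := P_neq (ltnW jN) (leqnn N) ltac:(lia).
    by rewrite Pj /slt /extreme_value; case: (d) => /=; lia.
  have ne : ~ extreme_word sigma (~~ d) =1 w0.
    move=> eqw; apply: (power_not_extreme K0 i0N PN) => m.
    by rewrite eq0 eqw.
  by case: (wlt_total sigma (~~ d) ne) => // /extreme_wordP.
(* The new tail must start after [w0] has already been separated from each power on the other side;
   [M] bounds all these places. *)
pose Q j m := slt d (P N) (P j) ->
  (forall i, i < m -> w0 i = power j i) /\
  slt (d (+) parity w0 m) (w0 m) (power j m).
have [j jN|M M_bound] := @uniform_bound N Q.
  case: (boolP (slt d (P N) (P j))) => [/(w0_below j jN)[m Hm]|/negP no].
    by exists m.
  by exists 0.
(* A multiple of the period of [w0] that exceeds [M]. *)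
pose l := (N - i0) * M.+1.
have w0_per m : w0 (l + m) = w0 m.
  by rewrite -!eq0 /power /per /l mulnC modnMDl.
exists (glue (2 * l) w0 b) => d' i iN lti.
have lt_w := wlt_glue_periodic w0_per ltb.
have [same|opp] := boolP (slt d (P i) (P N)).
  have -> : d' = d by move: lti same; rewrite /slt; case: (d'); case: (d); lia.
  case: (classic (power i =1 w0)) => [eqi|nei].
    by apply: eq_wltl lt_w => m; rewrite eqi.
  exact: wlt_trans (w0_strict _ _ iN same nei) lt_w.
have -> : d' = ~~ d by move: lti opp; rewrite /slt; case: (d'); case: (d); lia.
have ltNi : slt d (P N) (P i).
  by have [|//] := slt_total d (P_neq (ltnW iN) (leqnn N) ltac:(lia)); rewrite (negbTE opp).
have [m mM /(_ ltNi) [eqm ltm]] := M_bound i iN.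
have glueE q : q <= m -> glue (2 * l) w0 b q = w0 q.
  by move=> qm; rewrite /glue ifT // /l; nia.
apply/wltC; exists m; split=> [q qm|]; first by rewrite glueE ?eqm // ltnW.
by rewrite glueE // (@eq_parity _ _ _ w0) // => q qm; rewrite glueE // ltnW.
Qed.

(** Comparisons with the tail at [N] come from the separating word. Every other one is decided by
    the first letters or, when these agree, passes to the next pair of indices. *)
Lemma compatible_realizes : 0 < K -> exists s, realizes s.
Proof.
move=> K0; have [w w_lt] := strict_word K0.
pose s := glue N z w; exists s.
have tailN : tail N s =1 w by move=> m; rewrite /tail /s /glue ltnNge leq_addr /= addKn.
have tail_glue i : i < N -> tail i s =1 glue (N - i) (tail i z) w.
  move=> iN m; rewrite /tail /s /glue ltn_subRL subnBA ?(ltnW iN) //.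
  by rewrite [m + i]addnC.
have base d i : i < N -> slt d (P i) (P N) -> wlt d (tail i s) (tail N s).
  move=> iN lt; apply: (eq_wlt (fsym (tail_glue i iN)) (fsym tailN)).
  by apply: wlt_per_glue; [lia|apply: w_lt].
(* The measure [l] bounds the number of steps until the larger index reaches [N]. *)
suff H l d i j : i <= N -> j <= N -> N <= maxn i j + l -> slt d (P i) (P j) ->
    wlt d (tail i s) (tail j s).
  by move=> d i j iN jN; apply: (H N) => //; lia.
elim: l d i j => [|l IHl] d i j.
all: rewrite (leq_eqVlt i) (leq_eqVlt j) => /orP[/eqP->|iN] /orP[/eqP->|jN] max_ij lt.
all: try by [rewrite sltnn in lt|apply: base|apply/wltC; apply: base; rewrite // sltC].
  by lia.
have s0 q : q < N -> tail q s 0 = z q by move=> qN; rewrite /tail /s addn0 /glue qN.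
have [eqz|nez] := eqVneq (z i) (z j); last first.
  apply: wlt_head; rewrite !s0 //.
  have [|//|gt] := @slt_total d (z i) (z j); first by move/val_inj/eqP; apply/negP.
  have := @cls_mono _ cls_ok (P i) (P j); have := @cls_mono _ cls_ok (P j) (P i).
  move: lt gt (P_le (ltnW iN)) (P_le (ltnW jN)); rewrite /slt /z.
  by case: (d) => lt gt Pi Pj /(_ (ltnW _)) h1 /(_ (ltnW _)) h2; lia.
have eq0 : tail i s 0 = tail j s 0 by rewrite !s0.
apply/(wlt_shift sigma d eq0); rewrite s0 //.
have := IHl (d (+) neg (z i)) i.+1 j.+1 iN jN ltac:(lia).
rewrite -next_slt // => /(_ lt); apply: eq_wlt => m; by rewrite /tail /shift addSnnS.
Qed.

End Sufficiency.

End Realization.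

(** * Words with a star, their blocks, and patterns of length three *)

Section SequenceLemmas.

Implicit Types (tau u : seq (option nat)).

Lemma starts_withP tau u : starts_with tau u <->
  size u <= size tau /\ forall i, i < size u -> nth None tau i = nth None u i.
Proof.
rewrite /starts_with; split=> [E|[le E]].
  split=> [|i iu]; last by rewrite -E nth_take.
  by rewrite -E size_take_min geq_minr.
have sz : size (take (size u) tau) = size u by rewrite size_takel.
apply: (@eq_from_nth _ None) => // i; rewrite sz => iu.
by rewrite nth_take ?E.
Qed.

Lemma ends_withP tau u : ends_with tau u <->
  size u <= size tau /\
  forall i, i < size u -> nth None tau (size tau - size u + i) = nth None u i.
Proof.
split=> -[le E]; split=> //; first by move=> i _; rewrite -[in RHS]E nth_drop.
apply: (@eq_from_nth _ None) => [|i]; rewrite size_drop subKn // => iu.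
by rewrite nth_drop E.
Qed.

Lemma pairwise_pmap_id (r : rel nat) tau :
  pairwise r (pmap id tau) <->
  forall i j x y, i < j -> nth None tau i = Some x -> nth None tau j = Some y ->
    r x y.
Proof.
elim: tau => [|o tau IH] /=.
  by split=> // _ i j x y _; rewrite nth_nil.
have tailP : (forall i j x y, i < j -> nth None (o :: tau) i = Some x ->
    nth None (o :: tau) j = Some y -> r x y) -> pairwise r (pmap id tau).
  by move=> H; apply/IH => i j x y ij; apply: (H i.+1 j.+1).
case: o tailP => [a|] tailP /=; last first.
  split=> [/IH H|/tailP//]; case=> [|i] [|j] x y //=; exact: (H i j).
split=> [/andP[/allP ra /IH H]|H].
  case=> [|i] [|j] x y //=; last exact: (H i j).
  move=> _ [<-] Ey; apply: ra; rewrite mem_pmap map_id -Ey mem_nth //.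
  by case: ltnP => // le; rewrite nth_default in Ey.
rewrite tailP // andbT; apply/allP => y; rewrite mem_pmap map_id => yt.
by apply: (H 0 (index (Some y) tau).+1) => //=; apply: nth_index.
Qed.

Lemma sorted_block (r : rel nat) tau a b : transitive r ->
  sorted r (block tau a b) <->
  forall i j x y, a <= i < j -> j < b -> nth None tau i = Some x ->
    nth None tau j = Some y -> r x y.
Proof.
move=> r_trans; rewrite sorted_pairwise // pairwise_pmap_id.
split=> H i j x y.
  move=> aij jb Ex Ey; apply: (H (i - a) (j - a)); first by lia.
    by rewrite nth_take ?nth_drop ?subnKC //; lia.
  by rewrite nth_take ?nth_drop ?subnKC //; lia.
move=> ij Ex Ey.
have jb : j < b - a.
  rewrite ltnNge; apply/negP => le; move: Ey.
  by rewrite nth_default // size_take_min (leq_trans (geq_minl _ _)).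
move: Ex Ey; rewrite !nth_take ?nth_drop; try lia.
by apply: H; lia.
Qed.

Lemma is_rho_312 a b c :
  is_rho (fun u v : nat => u < v) [tuple a; b; c] [:: 3; 1; 2] <-> b < c < a.
Proof.
split=> [[_ rho]|lt].
  have := rho (inord 1) (inord 2); have := rho (inord 2) (inord 0).
  by rewrite !(tnth_nth 0) !inordK //= => -[_ ->] // [_ ->].
split=> // -[[|[|[|//]]] li] [[|[|[|//]]] lj]; rewrite !(tnth_nth 0) /=; split=> //; lia.
Qed.

Lemma is_rho_132 a b c :
  is_rho (fun u v : nat => u < v) [tuple a; b; c] [:: 1; 3; 2] <-> a < c < b.
Proof.
split=> [[_ rho]|lt].
  have := rho (inord 2) (inord 1); have := rho (inord 0) (inord 2).
  by rewrite !(tnth_nth 0) !inordK //= => -[_ ->] // [_ ->].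
split=> // -[[|[|[|//]]] li] [[|[|[|//]]] lj]; rewrite !(tnth_nth 0) /=; split=> //; lia.
Qed.

End SequenceLemmas.

(** * Translation between segmentations and block indices *)

Section Translation.

Variables (K : nat) (sigma : signature K.+1) (N : nat) (pi : 'S_N.+1).

Local Notation tau := (hat_star pi).
Local Notation neg := (neg sigma).
Implicit Types (e : seq nat) (cls : nat -> 'I_K.+1).

Let P i : nat := pi (inord i).

Lemma value_inj i j : i <= N -> j <= N -> P i = P j -> i = j.
Proof. by move=> iN jN /val_inj/perm_inj/(congr1 val) /=; rewrite !inordK. Qed.

Lemma value_le i : i <= N -> P i <= N.
Proof. by move=> _; rewrite -ltnS ltn_ord. Qed.

Lemma value_surj v : v <= N -> exists2 i, i <= N & P i = v.
Proof.
move=> vN; exists ((pi^-1)%g (inord v)); first by rewrite -ltnS ltn_ord.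
by rewrite /P inord_val permKV inordK.
Qed.

Lemma nth_one_line (p : 'S_N.+1) i : i <= N -> nth 0 (one_line p) i = (p (inord i)).+1.
Proof.
move=> iN; rewrite (nth_map ord0) ?size_enum_ord //.
by congr (p _).+1; apply: val_inj; rewrite /= nth_enum_ord ?inordK.
Qed.

Lemma entry_one_line m : m <= N -> entry (one_line pi) m.+1 = (P m).+1.
Proof. exact: nth_one_line. Qed.

Lemma size_one_line (p : 'S_N.+1) : size (one_line p) = N.+1.
Proof. by rewrite size_map size_enum_ord. Qed.

Lemma size_hat_star : size tau = N.+1.
Proof. by rewrite size_map size_one_line. Qed.

Lemma ordS_inord i : i < N -> ordS (inord i : 'I_N.+1) = inord i.+1.
Proof.
move=> iN; apply: val_inj; rewrite /= !inordK ?modn_small //; exact: leqW.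
Qed.

Lemma ordS_inord_max : ordS (inord N : 'I_N.+1) = ord0.
Proof. by apply: val_inj; rewrite /= inordK // modnn. Qed.

Lemma hatE x : hat pi (pi x) = pi (ordS x).
Proof. by rewrite permE permK. Qed.

(** The cycle takes each [pi_i] to [pi_(i+1)] and closes up at [pi_n], where the value [pi_1] is
    starred. Positions are shifted to start from 0, but the letters of [tau] still start from 1. *)
Lemma nth_hat_star i : i <= N ->
  nth None tau (P i) = if i < N then Some (P i.+1).+1 else None.
Proof.
move=> iN; have PN := value_le iN.
rewrite (nth_map 0) ?size_one_line // nth_one_line //.
rewrite inord_val hatE entry_one_line // eqSS /P.
have -> : inord 0 = ord0 :> 'I_N.+1 by apply: val_inj; rewrite /= inordK.
case: ltnP => [lt|ge]; last first.
  by have -> : i = N; [lia|rewrite ordS_inord_max eqxx].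
rewrite ordS_inord // ifF //; apply/eqP => /val_inj/perm_inj/(congr1 val).
by rewrite /= inordK.
Qed.

Lemma nth_hat_star_None v : v <= N -> nth None tau v = None -> P N = v.
Proof.
move=> vN; have [i iN <-] := value_surj vN; rewrite nth_hat_star //.
by case: ltnP => // ge _; congr P; lia.
Qed.

Lemma nth_hat_star_Some v x : v <= N -> nth None tau v = Some x.+1 ->
  exists2 i, i < N & P i = v /\ P i.+1 = x.
Proof.
move=> vN; have [i iN <-] := value_surj vN; rewrite nth_hat_star //.
by case: ltnP => // lt [<-]; exists i.
Qed.

(** For positions counted from 0, the bounds [e_t < p <= e_(t+1)] become [e_t <= v < e_(t+1)]. *)
Definition block_index e cls : Prop :=
  forall v (t : 'I_K.+1), v <= N ->
  (nth 0 e t <= v < nth 0 e t.+1) = (cls v == t).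

Record partition_seq e : Prop := PartitionSeq {
  part_size : size e = K.+2;
  part_first : nth 0 e 0 = 0;
  part_last : nth 0 e K.+1 = N.+1;
  part_sorted : sorted leq e
}.

Lemma part_le e i j : partition_seq e -> i <= j -> j <= K.+1 -> nth 0 e i <= nth 0 e j.
Proof.
case=> sz _ _ srt ij jK.
apply: (sorted_leq_nth leq_trans leqnn) => //; rewrite inE sz; lia.
Qed.

Lemma block_index_exists e : partition_seq e -> exists cls, block_index e cls.
Proof.
move=> pe; pose cls v : 'I_K.+1 :=
  odflt ord0 [pick t : 'I_K.+1 | nth 0 e t <= v < nth 0 e t.+1].
exists cls => v t vN; rewrite /cls; case: pickP => [u Hu|none] /=.
  apply/idP/eqP => [Ht|<-//]; apply: val_inj.
  have [ut|tu|//] := ltngtP u t.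
    by have := part_le pe ut (ltnW (ltn_ord t)); lia.
  by have := part_le pe tu (ltnW (ltn_ord u)); lia.
have [t0 Ht0] : exists t0 : 'I_K.+1, nth 0 e t0 <= v < nth 0 e t0.+1.
  (* The block containing [v] ends at the first [e_m] that exceeds [v]. *)
  have ex : exists m, v < nth 0 e m by exists K.+1; rewrite part_last.
  have [m vm mmin] := ex_minnP ex.
  have mK : m <= K.+1 by apply: mmin; rewrite part_last.
  case: m vm mmin mK => [|m] vm mmin mK; first by rewrite part_first in vm.
  exists (Ordinal mK); rewrite vm andbT leqNgt; apply/negP => /mmin.
  by rewrite ltnn.
by rewrite none in Ht0.
Qed.

Section Blocks.

Variables (e : seq nat) (cls : nat -> 'I_K.+1).
Hypothesis pe : partition_seq e.
Hypothesis e_cls : block_index e cls.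

Lemma cls_bounds v : v <= N -> nth 0 e (cls v) <= v < nth 0 e (cls v).+1.
Proof. by move=> vN; rewrite e_cls. Qed.

Lemma cls_ord0 v : v <= N -> (cls v == ord0) = (v < nth 0 e 1).
Proof. by move=> vN; rewrite -e_cls //= part_first. Qed.

Lemma cls_ord_max v : v <= N -> (cls v == ord_max) = (nth 0 e K <= v).
Proof. by move=> vN; rewrite -e_cls //= part_last // ltnS vN andbT. Qed.

Lemma block_index_mono a b : a <= b -> b <= N -> cls a <= cls b.
Proof.
move=> ab bN; rewrite leqNgt; apply/negP => lt.
have := cls_bounds bN; have := cls_bounds (leq_trans ab bN).
by have := part_le pe lt (ltnW (ltn_ord _)); lia.
Qed.

Lemma nth_signature (t : 'I_K.+1) : nth true sigma t = ~~ neg t.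
Proof. by rewrite negE negbK (tnth_nth true). Qed.

Lemma signature_orderE (t : 'I_K.+1) :
  (if tnth sigma t then ltn else gtn) =2 slt (neg t).
Proof. by move=> x y; rewrite negE; case: (tnth sigma t). Qed.

Lemma signature_order_trans (t : 'I_K.+1) :
  transitive (if tnth sigma t then ltn else gtn).
Proof.
by move=> y x z; rewrite !signature_orderE; apply: slt_trans.
Qed.

Lemma seg_aP :
  (forall t : 'I_K.+1, sorted (if tnth sigma t then ltn else gtn)
     (block tau (nth 0 e t) (nth 0 e t.+1))) <->
  (forall d i j, i < N -> j < N -> cls (P i) = cls (P j) ->
    slt d (P i) (P j) -> slt (d (+) neg (cls (P i))) (P i.+1) (P j.+1)).
Proof.
split=> [H d i j iN jN eq_cls lt|H t].
  have inc i' j' : i' < N -> j' < N -> cls (P i') = cls (P j') -> P i' < P j' ->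
      slt (neg (cls (P i'))) (P i'.+1) (P j'.+1).
    move=> i'N j'N eqc ltP.
    have /(sorted_block tau _ _ (@signature_order_trans (cls (P i')))) := H (cls (P i')).
    move/(_ (P i') (P j') (P i'.+1).+1 (P j'.+1).+1).
    rewrite signature_orderE !nth_hat_star ?(ltnW i'N) ?(ltnW j'N) // i'N j'N.
    have := cls_bounds (value_le (ltnW i'N)).
    have := cls_bounds (value_le (ltnW j'N)); rewrite -eqc => h1 h2.
    by move=> h; apply: h => //; lia.
  case: d lt => lt; last by apply: inc.
  by rewrite addTb sltC eq_cls; apply: inc.
apply/(sorted_block _ _ _ (@signature_order_trans t)) => v v' x y vv' v't.
have v'N : v' <= N.
  by have := part_le pe (ltn_ord t) (leqnn _); rewrite part_last //; lia.
have vN : v <= N by lia.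
(* The letters of [tau] other than the star are successors, so the letter 0 does not occur. *)
case: x => [|x]; first by have [i iN <-] := value_surj vN; rewrite nth_hat_star //; case: ifP.
case: y => [|y]; first by have [i iN <-] := value_surj v'N; rewrite nth_hat_star //; case: ifP.
move=> /(nth_hat_star_Some vN)[i iN [Pi <-]] /(nth_hat_star_Some v'N)[j jN [Pj <-]].
have ci : cls (P i) = t by apply/eqP; rewrite -e_cls Pi //; lia.
have cj : cls (P j) = t by apply/eqP; rewrite -e_cls Pj //; lia.
have := H false i j iN jN; rewrite ci cj Pi Pj signature_orderE.
by move/(_ erefl ltac:(rewrite /slt; lia)).
Qed.

(** By [extreme_preimage], a violation of [extreme_not_fixed] forces the prefix or suffix named in
    (b) or (c), and a violation of [extreme_not_swapped] forces those named in (d) or (e). The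
    bounds on [e] in these conditions then fail. *)
Lemma segmentation_compatible :
  segmentation sigma tau e -> compatible sigma N P cls.
Proof.
case=> _ _ _ _ /seg_aP next; rewrite /= size_hat_star subSS subn0 => segb segc segd sege.
have mono := block_index_mono.
have preim c v i := @extreme_preimage K sigma N P value_le value_surj cls c v i mono next.
have neq i j : i <= N -> j <= N -> i <> j -> P i <> P j.
  by move=> iN jN ne /value_inj - /(_ iN jN).
have sig0 : nth true sigma 0 = ~~ neg ord0 := nth_signature ord0.
have sigK : nth true sigma K = ~~ neg ord_max := nth_signature ord_max.
(* The star occupies the extreme position itself, so the outermost candidate is the position next to
   it. *)
have near d i : 0 < N -> i < N -> P N = extreme_value N d ->
    cls (P i) = extreme_letter K d ->
    P i.+1 = extreme_value N (d (+) neg (extreme_letter K d)) ->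
    P i = near_extreme_value N d.
  move=> N0 iN PN clsi Pi1; apply: preim clsi Pi1 => //.
  - by rewrite /near_extreme_value; case: (d); lia.
  - by rewrite PN /near_extreme_value /extreme_value; case: (d); lia.
  - have := neq i N (ltnW iN) (leqnn N) ltac:(lia); have := value_le (ltnW iN).
    by rewrite PN /near_extreme_value /extreme_value /slt; case: (d); lia.
split=> // [d N0 pos PN clsN|d N1 n1 n2 PN clsN1 clsN2].
  have lN1 : N.-1 < N by lia.
  have EN : N.-1.+1 = N by lia.
  have PN1 : P N.-1 = near_extreme_value N d.
    by apply: near clsN _ => //; rewrite EN (negbTE pos) addbF.
  have tauN := nth_hat_star (leqnn N); rewrite ltnn in tauN.
  have tauN1 := nth_hat_star (ltnW lN1); rewrite lN1 EN in tauN1.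
  case: d PN pos clsN PN1 => PN pos clsN PN1; rewrite PN PN1 /= in tauN tauN1 clsN.
    have := segc; rewrite sigK pos => /(_ erefl).
    have /eqP := clsN; rewrite cls_ord_max ?leq_pred // => le.
    suff H : ends_with tau [:: Some N.+1; None] by move/(_ H); lia.
    apply/ends_withP; rewrite size_hat_star /=; split; first by lia.
    case=> [|[|//]] _ /=.
      by rewrite -[RHS]tauN1; congr nth; lia.
    by rewrite -[RHS]tauN; congr nth; lia.
  have := segb; rewrite sig0 pos => /(_ erefl).
  have /eqP := clsN; rewrite cls_ord0 // => le.
  suff H : starts_with tau [:: None; Some 1] by move/(_ H); lia.
  apply/starts_withP; rewrite size_hat_star /=; split; first by lia.
  by case=> [|[|//]] _ /=.
have lN1 : N.-1 < N by lia.
have lN2 : N.-2 < N by lia.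
have EN : N.-1.+1 = N by lia.
have EN1 : N.-2.+1 = N.-1 by lia.
have PN1 : P N.-1 = extreme_value N (~~ d).
  apply: preim clsN1 _ => //; first by case: (d).
  - by rewrite PN; case: (d) => /=; lia.
  - by have := value_le (ltnW lN1); rewrite /slt; case: (d) => /=; lia.
  - by rewrite EN n2 addbT negbK.
have PN2 : P N.-2 = near_extreme_value N d.
  by apply: near clsN2 _ => //; [lia|rewrite EN1 n1 addbT].
have tauN := nth_hat_star (leqnn N); rewrite ltnn in tauN.
have tauN1 := nth_hat_star (ltnW lN1); rewrite lN1 EN in tauN1.
have tauN2 := nth_hat_star (ltnW lN2); rewrite lN2 EN1 in tauN2.
case: d PN n1 n2 clsN1 clsN2 PN1 PN2 => /= PN n1 n2 clsN1 clsN2 PN1 PN2;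
  rewrite PN PN1 ?PN2 /= in tauN tauN1 tauN2 clsN1 clsN2.
  have := segd; rewrite sig0 sigK n1 n2 => /(_ erefl erefl).
  have /eqP := clsN1; rewrite cls_ord0 // => le1.
  have /eqP := clsN2; rewrite cls_ord_max ?leq_pred // => le2.
  have H1 : starts_with tau [:: Some N.+1].
    by apply/starts_withP; rewrite size_hat_star; split=> // -[].
  have H2 : ends_with tau [:: Some 1; None].
    apply/ends_withP; rewrite size_hat_star /=; split; first by lia.
    case=> [|[|//]] _ /=.
      by rewrite -[RHS]tauN2; congr nth; lia.
    by rewrite -[RHS]tauN; congr nth; lia.
  by move=> /(_ H1 H2); lia.
have := sege; rewrite sig0 sigK n1 n2 => /(_ erefl erefl).
have /eqP := clsN1; rewrite cls_ord_max // => le1.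
have /eqP := clsN2; rewrite cls_ord0 //; last by lia.
move=> le2.
have H1 : ends_with tau [:: Some 1].
  apply/ends_withP; rewrite size_hat_star; split=> // -[|//] _.
  by rewrite /= -[RHS]tauN1; congr nth; lia.
have H2 : starts_with tau [:: None; Some N.+1].
  apply/starts_withP; rewrite size_hat_star /=; split; first by lia.
  by case=> [|[|//]] _ /=.
by move=> /(_ H1 H2); lia.
Qed.

(** The prefixes and suffixes in (b)-(e) determine [P N], [P N.-1] and, for (d) and (e), [P N.-2].
    If the required bounds on [e] failed, these would lie in the blocks that compatibility
    forbids. *)
Lemma compatible_segmentation :
  compatible sigma N P cls -> segmentation sigma tau e.
Proof.
case=> mono next fixed swapped.
have sig0 : nth true sigma 0 = ~~ neg ord0 := nth_signature ord0.
have sigK : nth true sigma K = ~~ neg ord_max := nth_signature ord_max.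
have prevE i j : i < N -> j <= N -> P i.+1 = P j -> i.+1 = j.
  by move=> iN jN; apply: value_inj.
case: (pe) => sz first last srt; split=> //; rewrite ?size_hat_star //=.
- by apply/seg_aP.
- rewrite sig0 => pos /starts_withP[]; rewrite size_hat_star /= => N1 E.
  have PN := nth_hat_star_None (leq0n N) (E 0 erefl).
  have [i iN [Pi Pi1]] := nth_hat_star_Some (ltac:(lia) : 1 <= N) (E 1 erefl).
  have iN1 := prevE i N iN (leqnn N) ltac:(by rewrite Pi1 PN).
  rewrite leqNgt; apply/negP => lt; apply: (fixed false) => //.
  by apply/eqP; rewrite -iN1 /= Pi cls_ord0 //; lia.
- rewrite sigK subSS subn0 => pos /ends_withP[]; rewrite size_hat_star /= => N1 E.
  have PN : P N = N.
    by apply: nth_hat_star_None => //; rewrite -[RHS](E 1 erefl); congr nth; lia.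
  have [i iN [Pi Pi1]] := @nth_hat_star_Some N.-1 N ltac:(lia)
    ltac:(by rewrite -[RHS](E 0 erefl); congr nth; lia).
  have iN1 := prevE i N iN (leqnn N) ltac:(by rewrite Pi1 PN).
  rewrite leqNgt; apply/negP => lt; apply: (fixed true) => //.
  by apply/eqP; rewrite -{1}iN1 /= Pi cls_ord_max //; lia.
- rewrite sig0 sigK subSS subn0 => /negbFE n0 /negbFE nK /starts_withP[].
  rewrite size_hat_star /= => _ /(_ 0 erefl) /= E0.
  move/ends_withP; rewrite size_hat_star /= => -[N1 E].
  have PN : P N = N.
    by apply: nth_hat_star_None => //; rewrite -[RHS](E 1 erefl); congr nth; lia.
  have [i iN [Pi Pi1]] := nth_hat_star_Some (leq0n N) E0.
  have [j jN [Pj Pj1]] := @nth_hat_star_Some N.-1 0 ltac:(lia)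
    ltac:(by rewrite -[RHS](E 0 erefl); congr nth; lia).
  have iN1 := prevE i N iN (leqnn N) ltac:(by rewrite Pi1 PN).
  have ji := prevE j i jN (ltnW iN) ltac:(by rewrite Pj1 Pi).
  have [->|e1] := eqVneq (nth 0 e 1) 0; [by left|right].
  rewrite leqNgt; apply/negP => lt; apply: (swapped true) => //; first by lia.
    by apply/eqP; rewrite -iN1 /= Pi cls_ord0 ?lt0n.
  apply/eqP; rewrite -iN1 -ji /= Pj cls_ord_max; lia.
- rewrite sig0 sigK => /negbFE n0 /negbFE nK /ends_withP[].
  rewrite size_hat_star /= subSS subn0 => _ /(_ 0 erefl); rewrite addn0 /= => EN.
  move/starts_withP; rewrite size_hat_star /= => -[N1 E].
  have PN := nth_hat_star_None (leq0n N) (E 0 erefl).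
  have [i iN [Pi Pi1]] := nth_hat_star_Some (leqnn N) EN.
  have [j jN [Pj Pj1]] := nth_hat_star_Some (ltac:(lia) : 1 <= N) (E 1 erefl).
  have iN1 := prevE i N iN (leqnn N) ltac:(by rewrite Pi1 PN).
  have ji := prevE j i jN (ltnW iN) ltac:(by rewrite Pj1 Pi).
  have [lt|] := ltnP 1 (nth 0 e 1); [left|by right].
  have := part_le pe (leqnSn K) (leqnn _); rewrite last leq_eqVlt => /orP[/eqP//|leK].
  case: (swapped false); rewrite //=; first by lia.
    by apply/eqP; rewrite -iN1 /= Pi cls_ord_max.
  by apply/eqP; rewrite -iN1 -ji /= Pj cls_ord0 //; lia.
Qed.

Lemma dagger_obstructionE b :
  dagger_obstruction K.+1 pi e b <-> obstructed N P cls b.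
Proof.
have entryE m : m <= N -> entry (one_line pi) (N.+1 - m) = (P (N - m)).+1.
  by move=> mN; rewrite subSn // entry_one_line ?leq_subr.
have cls_entry m t : m <= N -> t < K.+1 ->
    (nth 0 e t < (P m).+1 <= nth 0 e t.+1) = (cls (P m) == t :> nat).
  by move=> mN tK; rewrite ltnS (e_cls (Ordinal tK) (value_le mN)).
have blockE i : 2 * b <= N -> i <= b ->
    (forall t, t < K.+1 ->
      nth 0 e t < entry (one_line pi) (N.+1 - b - i) <= nth 0 e t.+1 <->
      nth 0 e t < entry (one_line pi) (N.+1 - i) <= nth 0 e t.+1) <->
    cls (P (N - b - i)) = cls (P (N - i)).
  move=> bN ib; rewrite -!subnDA !entryE; try lia.
  split=> [H|eq_cls t tK]; last by rewrite !cls_entry ?leq_subr // eq_cls.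
  have := H (cls (P (N - i))) (ltn_ord _).
  rewrite !cls_entry ?leq_subr // eqxx => -[_ /(_ erefl)/eqP]; exact: val_inj.
have rhoE : 2 * b <= N -> 0 < b ->
    (is_rho (fun u v : nat => u < v) [tuple entry (one_line pi) (N.+1 - 2 * b);
       entry (one_line pi) (N.+1 - b); entry (one_line pi) N.+1] [:: 3; 1; 2] \/
     is_rho (fun u v : nat => u < v) [tuple entry (one_line pi) (N.+1 - 2 * b);
       entry (one_line pi) (N.+1 - b); entry (one_line pi) N.+1] [:: 1; 3; 2]) <->
    (P (N - 2 * b) < P N) != (P (N - b) < P N).
  move=> bN b0; rewrite is_rho_312 is_rho_132 !entryE ?entry_one_line //; try lia.
  have n1 : P (N - 2 * b) <> P N by move/value_inj; lia.
  have n2 : P (N - b) <> P N by move/value_inj; lia.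
  by lia.
split=> -[b0 bN rho H].
  have {}bN : 2 * b <= N by lia.
  split=> //; first by apply/rhoE.
  by move=> i /andP[i0 ib]; apply/blockE => // t tK; apply: H; rewrite ?i0.
split=> //; [by lia|exact/rhoE|].
by move=> i t /andP[i0 ib]; move: t; apply/blockE => //; apply: H; rewrite i0.
Qed.

End Blocks.

Lemma segmentation_partition e : segmentation sigma tau e -> partition_seq e.
Proof. by case=> sz first last srt *; split=> //; rewrite last size_hat_star. Qed.

Lemma hat_full_cycle : is_full_cycle (hat pi).
Proof.
have orbit0 : porbit (hat pi) (pi ord0) = setT.
  apply/setP => y; rewrite inE; apply/porbitP; exists ((pi^-1)%g y).
  have iterE m : m <= N -> (hat pi ^+ m)%g (pi ord0) = pi (inord m).
    elim: m => [|m IHm] mN.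
      by rewrite expg0 perm1; congr (pi _); apply: val_inj; rewrite /= inordK.
    by rewrite expgSr permM IHm ?(ltnW mN) // hatE ordS_inord.
  by rewrite iterE ?inord_val ?permKV // -ltnS ltn_ord.
apply/setP => X; rewrite inE; apply/imsetP/eqP => [[x _ ->]|->]; last by exists (pi ord0).
by rewrite -orbit0; apply/eqP; rewrite eq_porbit_mem orbit0 inE.
Qed.

Lemma hat_star_in_C_star : in_C_star N.+1 tau.
Proof.
exists (hat pi), (entry (one_line pi) 1); split=> //; first exact: hat_full_cycle.
rewrite entry_one_line //; apply/mapP; exists (pi (inord N)); first exact: mem_enum.
rewrite hatE ordS_inord_max /P; congr (pi _).+1.
by apply: val_inj; rewrite /= inordK.
Qed.

Lemma perm_eq_one_line : perm_eq (one_line pi) (iota 1 N.+1).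
Proof.
apply: uniq_perm; rewrite ?iota_uniq //.
  by rewrite map_inj_uniq ?enum_uniq // => x y [/val_inj/perm_inj].
move=> v; rewrite mem_iota add1n; apply/mapP/idP => [[i _ ->]|].
  by rewrite !ltnS /= -ltnS ltn_ord.
case: v => // v; rewrite ltnS => vN; exists ((pi^-1)%g (inord v)); first exact: mem_enum.
by rewrite permKV inordK.
Qed.

Lemma is_Pat_realizes s : is_Pat sigma s pi <-> realizes sigma N P s.
Proof.
have nthE (i : 'I_N.+1) : nth 0 (one_line pi) i = (P i).+1.
  by rewrite nth_one_line // -ltnS ltn_ord.
have precP (i j : 'I_N.+1) :
    prec sigma (tnth [tuple iter i (@shift K.+1) s | i < N.+1] i)
      (tnth [tuple iter i (@shift K.+1) s | i < N.+1] j) <->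
    wlt sigma false (tail i s) (tail j s).
  rewrite !tnth_mktuple precE; split; apply: eq_wlt => m; rewrite ?iter_shift //.
split=> [[_ [_ pat]] d i j iN jN|real].
  suff H a b : a <= N -> b <= N -> P a < P b -> wlt sigma false (tail a s) (tail b s).
    by case: d => lt; [apply/wltC|]; apply: H.
  move=> aN bN lt; have [_] := pat (inord a) (inord b).
  rewrite !nthE ltnS /P !inord_val => /(_ lt) /precP.
  by rewrite !inordK.
have le (i : 'I_N.+1) : i <= N by rewrite -ltnS ltn_ord.
have neq (i j : 'I_N.+1) : i != j -> P i <> P j.
  by move=> /eqP ne /value_inj E; apply: ne; apply: val_inj; apply: E.
split=> [i j ij eq_ij|].
  have [d lt] := slt_dir (neq i j ij).
  apply: (wlt_neq (real d i j (le i) (le j) lt)) => m.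
  by rewrite -!iter_shift eq_ij.
split=> [|i j]; first exact: perm_eq_one_line.
rewrite !nthE ltnS; split=> [/precP|lt].
  exact: (@realizes_reflect _ _ _ _ value_inj s false).
by apply/precP; apply: (real false).
Qed.

Lemma card_rank_lt v : v <= N.+1 -> #|[set i : 'I_N.+1 | P i < v]| = v.
Proof.
move=> vN; rewrite -[RHS]card_ord.
have widen_inj : injective (widen_ord vN) by move=> x y /(congr1 val) /= /val_inj.
rewrite -(card_imset _ widen_inj) -[RHS](card_preimset _ (@perm_inj _ pi)).
apply: eq_card => i; rewrite !inE /P inord_val.
apply/idP/imsetP => [lt|[x _ ->]]; last exact: (ltn_ord x).
by exists (Ordinal lt) => //; apply: val_inj.
Qed.

(** * The segmentation read off a realizing word *)

Section LetterCounts.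

Variable s : word K.+1.
Hypothesis s_real : realizes sigma N P s.

(** First letters increase weakly with the values, so the values with letter below [t] form an
    initial interval; [e_t] is its length. *)
Let e := mkseq (fun t => #|[set i : 'I_N.+1 | s i < t]|) K.+2.
Let cls v := s ((pi^-1)%g (inord v)).

Lemma letter_cls i : i <= N -> cls (P i) = s i.
Proof. by move=> iN; rewrite /cls /P inord_val permK inordK. Qed.

Lemma letter_mono i j : i <= N -> j <= N -> P i < P j -> s i <= s j.
Proof.
move=> iN jN lt; rewrite leqNgt; apply/negP => gt.
apply: (wlt_asym (@s_real false i j iN jN lt)); apply: wlt_head.
by rewrite /tail !addn0.
Qed.

Lemma letter_partition : partition_seq e.
Proof.
split.
- by rewrite size_mkseq.
- by rewrite nth_mkseq //; apply: eq_card0 => i; rewrite inE.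
- by rewrite nth_mkseq // -[RHS](card_ord N.+1); apply: eq_card => i; rewrite inE ltn_ord.
- apply/(sortedP 0) => t; rewrite size_mkseq => tK.
  rewrite !nth_mkseq ?(ltnW tK) //; apply: subset_leq_card; apply/subsetP => i.
  by rewrite !inE; apply: leqW.
Qed.

(** Exactly [v] indices have value below [v], so both bounds on [P i] follow by comparing index
    sets: smaller letters force smaller values, and smaller values have letters at most as large. *)
Lemma letter_block_index : block_index e cls.
Proof.
have bounds i : i <= N -> nth 0 e (s i) <= P i < nth 0 e (s i).+1.
  move=> iN; have siK := ltn_ord (s i); rewrite !nth_mkseq ?(leqW siK) //.
  apply/andP; split.
    rewrite -[leqRHS](@card_rank_lt (P i)); last exact/leqW/value_le.
    apply: subset_leq_card; apply/subsetP => j; rewrite !inE => lt.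
    have jN : j <= N by rewrite -ltnS ltn_ord.
    rewrite ltnNge leq_eqVlt; apply/negP => /orP[/eqP/value_inj E|/letter_mono le].
      by rewrite E // ltnn in lt.
    by have := le iN jN; lia.
  rewrite -[leqLHS](@card_rank_lt (P i).+1); last by rewrite ltnS value_le.
  apply: subset_leq_card; apply/subsetP => j; rewrite !inE ltnS => lt.
  have jN : j <= N by rewrite -ltnS ltn_ord.
  move: lt; rewrite leq_eqVlt ltnS => /orP[/eqP/value_inj->//|/letter_mono]; exact.
move=> v t vN; have [i iN <-] := value_surj vN; rewrite letter_cls //.
apply/idP/eqP => [Ht|<-]; last exact: bounds.
apply: val_inj; have := bounds i iN.
have [ut|tu|//] := ltngtP (s i) t.
  by have := part_le letter_partition ut (ltnW (ltn_ord t)); lia.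
by have := part_le letter_partition tu (ltnW (ltn_ord (s i))); lia.
Qed.

Lemma realizes_segmentation :
  segmentation sigma tau e /\ ~ exists b, dagger_obstruction K.+1 pi e b.
Proof.
have pe := letter_partition; have be := letter_block_index; split.
  apply: (compatible_segmentation pe be).
  exact: (realizes_compatible value_inj value_le value_surj s_real letter_cls).
case=> b /(dagger_obstructionE be).
exact: (realizes_unobstructed value_inj s_real letter_cls).
Qed.

End LetterCounts.

End Translation.

Theorem theorem2p1 (k : nat) (sigma : signature k) (n : nat) (pi : 'S_n) :
  2 <= k -> 1 <= n ->
  allowed sigma pi <->
  in_C_sigma_star sigma (hat_star pi) /\ dagger sigma pi.
Proof.
case: k sigma => [//|K] sigma K0; case: n pi => [//|N] pi _.
split=> [[s /is_Pat_realizes s_real]|[_ [e [seg free]]]].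
  have [seg free] := realizes_segmentation s_real.
  split; last by eexists; split; [exact: seg|].
  split; last by eexists; exact: seg.
  by exists N.+1; apply: hat_star_in_C_star.
have pe := segmentation_partition seg.
have [cls be] := block_index_exists pe.
have [b obs|s s_real] := compatible_realizes (@value_inj N pi) (@value_le N pi)
  (@value_surj N pi) (segmentation_compatible pe be seg) _ K0.
  by apply: free; exists b; apply: (proj2 (dagger_obstructionE pi be b)).
by exists s; apply/is_Pat_realizes.
Qed.
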